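(* Let $0<\alpha<1$. There exists a constant $c(\alpha)>0$, depending only on $\alpha$, such that for every $f\in\Lambda_{\alpha}([-1,2])$ with $\|f\|_{\alpha}\le1$, every positive integer $N$ and every $t>0$, $$\left|\left\{x\in[0,1]:\Theta^{*}_{2^{-N}}(f)(x)>\sqrt{N}\,t\right\}\right|\le c(\alpha)\exp\left(-t^{2}/c(\alpha)\right),$$ where $|\cdot|$ denotes Lebesgue measure.
   Context: For $0<\alpha<1$, $\Lambda_{\alpha}([-1,2])$ is the class of functions $f\colon[-1,2]\to\mathbb{R}$ for which there exists a constant $C>0$ with $|f(x)-f(y)|\le C|x-y|^{\alpha}$ for all $x,y\in[-1,2]$; the infimum of such $C$ is denoted by $\|f\|_{\alpha}$. For $x\in[0,1]$ and $N=1,2,\dots$, $$\Theta_{2^{-N}}(f)(x)=\int_{2^{-N}}^{1}\frac{f(x+h)-f(x-h)}{h^{\alpha}}\,\frac{dh}{h},\qquad \Theta^{*}_{2^{-N}}(f)(x)=\sup_{1\le k\le N}|\Theta_{2^{-k}}(f)(x)|.$$ *)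

(* Defs.v *)
From HB Require Import structures.
From mathcomp Require Import all_boot all_order all_algebra.
From mathcomp Require Import all_classical all_reals all_analysis.

Set Implicit Arguments.
Unset Strict Implicit.
Unset Printing Implicit Defensive.

Import Order.TTheory GRing.Theory Num.Theory.
Import numFieldNormedType.Exports.

Local Open Scope classical_set_scope.
Local Open Scope ring_scope.

(* A function on [-1, 2] is represented by a total function R -> R; every
   definition below only reads its values on [-1, 2] (when 0 <= x <= 1). *)

Definition holder_constants (R : realType) (alpha : R) (f : R -> R) : set R :=
  [set C | 0 < C /\
    forall x y, x \in `[(-1)%R, 2%R] -> y \in `[(-1)%R, 2%R] ->
      `|f x - f y| <= C * `|x - y| `^ alpha].

Definition Lambda (R : realType) (alpha : R) : set (R -> R) :=
  [set f | holder_constants alpha f !=set0].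

Definition holder_norm (R : realType) (alpha : R) (f : R -> R) : R :=
  inf (holder_constants alpha f).

Definition Theta (R : realType) (alpha eps : R) (f : R -> R) (x : R) : R :=
  (\int[lebesgue_measure]_(h in `[eps, 1])
     ((f (x + h) - f (x - h)) / h `^ alpha / h))%R.

(* [Theta_star alpha N] is the maximal operator at scale 2^-N. *)
Definition Theta_star (R : realType) (alpha : R) (N : nat) (f : R -> R)
    (x : R) : R :=
  sup [set `|Theta alpha (2 ^- k) f x| | k in [set k | (1 <= k <= N)%N]].

(* Main.v *)
Require Import Defs.
From HB Require Import structures.
From mathcomp Require Import all_boot all_order all_algebra.
From mathcomp Require Import all_classical all_reals all_analysis.
From mathcomp Require Import ring lra.
Set Implicit Arguments.
Unset Strict Implicit.
Unset Printing Implicit Defensive.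
Import Order.TTheory GRing.Theory Num.Theory.
Import numFieldNormedType.Exports.
Local Open Scope classical_set_scope.
Local Open Scope ring_scope.

(** Write [d = 2^-N].  The idea is that [Theta_(2^-k)] is, up to a bounded error,
    the [k]-th term of a dyadic martingale with bounded increments, so that
    Azuma's inequality, in its maximal form, gives Gaussian tails at scale
    [sqrt N].

    The martingale is the average of [Theta_d] over the points [a + i d] of a
    dyadic interval [[a, a + 2^m d]], where [k = N - m].  It stays close to
    [Theta_(2^m d)] on that interval for two reasons.
    - The part of the integral over [h >= 2^m d] varies by [O(1)] on an interval
      of length [2^m d], because of the Hoelder condition
      ([kernel_integral_symdiff_dist]).
    - The part over [d <= h <= 2^m d] has average [O(1)]
      ([kernel_integral_symdiff_sum]).  For fixed [h], if [2 h] were equal to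
      [p d], the sum over [i < n] of [g (x + i d + h) - g (x + i d - h)] would be
      a sum of [F (i + p) - F i], and this equals the sum over [i < p] of
      [F (i + n) - F i] ([sum_shift_swap]): a sum of about [2 h / d] terms of size
      [(n d)^alpha], hence an average of order [h (n d)^(alpha - 1)], which is
      integrable against [h^(-1 - alpha)] with a bound independent of [n d].
      Rounding [2 h] to a multiple of [d] costs [d^alpha] on average, and
      [d^alpha h^(-1 - alpha)] has bounded integral over [h >= d].
    Replacing integrals over dyadic intervals by finite averages makes the
    martingale a function on a finite binary tree and avoids any exchange of
    integrals.

    The maximal inequality follows by induction on the tree
    ([exceedance_set_measure]): the union of the dyadic intervals on which the
    martingale exceeds [s] is computed recursively from the root, and its measure
    is controlled by the exponential of the value at the root.  Choosing the
    exponential parameter of order [t / sqrt N] gives the upper tail, and applying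
    this to [- g] gives the lower one.

    The Hoelder condition is assumed on [[-1, 2]] only; composing [f] with the
    projection onto this interval gives a function which satisfies it on the whole
    line and has the same [Theta] on [[0, 1]]. *)

(** * Integrals against the kernel [h^(-1 - alpha)] *)

(** Kept as a functional of the numerator [u], so that the linearity and the size
    of [Theta] can be studied separately. *)
Definition kernel_integral (R : realType) (alpha a b : R) (u : R -> R) : R :=
  (\int[lebesgue_measure]_(h in `[a, b]) (u h / h `^ alpha / h))%R.

Lemma kernel_continuous (R : realType) (alpha a b : R) (u : R -> R) :
  0 < a -> continuous u ->
  {within `[a, b], continuous (fun h => u h / h `^ alpha / h)}.
Proof.
move=> a0 cu; apply: continuous_in_subspaceT => h; rewrite inE/= in_itv/= => /andP[ah _].
have h0 : 0 < h := lt_le_trans a0 ah.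
apply: cvgM; last by apply: cvgV; [rewrite gt_eqF|exact: cvg_id].
apply: cvgM; first exact: cu.
apply: cvgV; first by rewrite gt_eqF// powR_gt0.
apply: (@differentiable_continuous R R^o R^o h (@powR R ^~ alpha)).
by apply/derivable1_diffP; apply: derivable_powR; rewrite in_itv/= h0.
Qed.

Lemma kernel_integrable (R : realType) (alpha a b : R) (u : R -> R) :
  0 < a -> continuous u ->
  lebesgue_measure.-integrable `[a, b]
    (EFin \o (fun h => u h / h `^ alpha / h)).
Proof.
move=> a0 cu; apply: continuous_compact_integrable.
  exact: segment_compact.
exact: kernel_continuous.
Qed.

Lemma kernel_integralB (R : realType) (alpha a b : R) (u v : R -> R) :
  0 < a -> continuous u -> continuous v ->
  kernel_integral alpha a b (fun h => u h - v h) =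
  kernel_integral alpha a b u - kernel_integral alpha a b v.
Proof.
move=> a0 cu cv; rewrite /kernel_integral -RintegralB//.
- by under eq_Rintegral do rewrite !mulrBl.
- exact: kernel_integrable.
- exact: kernel_integrable.
Qed.

Lemma kernel_integralD (R : realType) (alpha a b : R) (u v : R -> R) :
  0 < a -> continuous u -> continuous v ->
  kernel_integral alpha a b (fun h => u h + v h) =
  kernel_integral alpha a b u + kernel_integral alpha a b v.
Proof.
move=> a0 cu cv; rewrite /kernel_integral -RintegralD//.
- by under eq_Rintegral do rewrite !mulrDl.
- exact: kernel_integrable.
- exact: kernel_integrable.
Qed.

Lemma continuous_sum_ord (R : realType) (u : nat -> R -> R) (n : nat) :
  (forall i, continuous (u i)) -> continuous (fun h => \sum_(i < n) u i h).
Proof.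
move=> cu; elim: n => [|n IH] x.
  by under eq_fun do rewrite big_ord0; exact: cvg_cst.
under eq_fun do rewrite big_ord_recr/=.
by apply: cvgD; [exact: IH|exact: cu].
Qed.

Lemma kernel_integral_sum (R : realType) (alpha a b : R) (u : nat -> R -> R)
    (n : nat) :
  0 < a -> (forall i, continuous (u i)) ->
  kernel_integral alpha a b (fun h => \sum_(i < n) u i h) =
  \sum_(i < n) kernel_integral alpha a b (u i).
Proof.
move=> a0 cu; elim: n => [|n IH].
  rewrite big_ord0 /kernel_integral; under eq_Rintegral do rewrite big_ord0 !mul0r.
  by rewrite Rintegral_cst// mul0r.
rewrite big_ord_recr/= -IH -kernel_integralD//; last exact: continuous_sum_ord.
by congr kernel_integral; apply/funext => h; rewrite big_ord_recr.
Qed.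

Lemma kernel_integral_cat (R : realType) (alpha a b c : R) (u : R -> R) :
  0 < a -> a <= b -> b <= c -> continuous u ->
  kernel_integral alpha a c u =
  kernel_integral alpha a b u + kernel_integral alpha b c u.
Proof.
move=> a0 ab bc cu; rewrite /kernel_integral.
apply/eqP; rewrite addrC -subr_eq Rintegral_itvB ?bnd_simp//.
  apply/eqP.
  have ibc := @kernel_integrable _ alpha b c u (lt_le_trans a0 ab) cu.
  rewrite Rintegral_itv_obnd_cbnd//.
  by apply: integrableS ibc => //; exact: subset_itv_oc_cc.
exact: kernel_integrable.
Qed.

(** Every estimate of the proof is an instance of this one.  The constant part of
    the bound on [u] integrates to at most [A a^(-alpha) / alpha], dominated by
    the lower end of the range, and the linear part to at most
    [B b^(1 - alpha) / (1 - alpha)], dominated by the upper end. *)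
Lemma kernel_integral_le (R : realType) (alpha a b A B : R) (u : R -> R) :
  0 < alpha < 1 -> 0 < a -> a <= b -> 0 <= A -> 0 <= B -> continuous u ->
  (forall h, a <= h <= b -> `|u h| <= A + B * h) ->
  `|kernel_integral alpha a b u| <=
    A * a `^ (- alpha) / alpha + B * b `^ (1 - alpha) / (1 - alpha).
Proof.
move=> /andP[al0 al1] a0; rewrite le_eqVlt => /predU1P[<-|ab] A0 B0 cu uAB.
  rewrite /kernel_integral set_itv1 Rintegral_set1 normr0.
  by rewrite addr_ge0// divr_ge0 ?mulr_ge0 ?powR_ge0//; lra.
have b0 := lt_trans a0 ab.
apply: (le_trans (le_normr_Rintegral _ _)) => //; first exact: kernel_integrable.
(* [F] is a primitive of the majorant [w]. *)
pose F (h : R) := - (A / alpha) * h `^ (- alpha) + B / (1 - alpha) * h `^ (1 - alpha).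
pose w (h : R) := (A + B * h) / h `^ alpha / h.
have cw : continuous (fun h : R => A + B * h).
  by move=> h; apply: cvgD; [exact: cvg_cst|apply: cvgM; [exact: cvg_cst|exact: cvg_id]].
have dF (h : R) : 0 < h -> is_derive h 1 F (w h).
  move=> h0.
  have -> : w h = - (A / alpha) * (- alpha * h `^ (- alpha - 1)) +
      B / (1 - alpha) * ((1 - alpha) * h `^ (1 - alpha - 1)).
    rewrite /w (_ : 1 - alpha - 1 = - alpha); last by ring.
    rewrite powRB; last by apply/implyP => _; rewrite gt_eqF.
    rewrite powRN powRr1 1?ltW//.
    field.
    rewrite !gt_eqF ?powR_gt0//; lra.
  by apply: is_deriveD; apply: is_deriveZ; exact: is_derive1_powR.
have FTC : (\int[lebesgue_measure]_(h in `[a, b]) w h)%R = F b - F a.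
  rewrite /Rintegral (@continuous_FTC2 _ w F)//.
  - exact: kernel_continuous.
  - have cF (h : R) : 0 < h -> {for h, continuous F}.
      move=> h0; apply: (@differentiable_continuous R R^o R^o h F).
      by apply/derivable1_diffP; have [] := dF h h0.
    split.
    + move=> h /[!in_itv]/= /andP[ah _].
      by have [] := dF h (lt_trans a0 ah).
    + exact: cvg_at_right_filter (cF _ a0).
    + exact: cvg_at_left_filter (cF _ b0).
  - move=> h /[!in_itv]/= /andP[ah _].
    by rewrite derive1E; have [] := dF h (lt_trans a0 ah).
apply: (@le_trans _ _ (F b - F a)).
  rewrite -FTC; apply: le_Rintegral => //.
  - by apply: integrable_norm; exact: kernel_integrable.
  - exact: kernel_integrable.
  - move=> h /=; rewrite in_itv/= => /andP[ah hb].
    have h0 : 0 < h := lt_le_trans a0 ah.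
    rewrite !normrM !normfV (gtr0_norm h0) (gtr0_norm (powR_gt0 _ h0)).
    apply: ler_wpM2r; first by rewrite invr_ge0 ltW.
    apply: ler_wpM2r; first by rewrite invr_ge0 powR_ge0.
    by apply: uAB; rewrite ah.
rewrite /F.
have := powR_ge0 b (-alpha); have := powR_ge0 a (1 - alpha).
set x := powR _ _; set y := powR _ _; set z := powR _ _; set v := powR _ _ => x0 y0.
have h1 : 0 <= A / alpha * y by rewrite mulr_ge0// divr_ge0// ltW.
have h2 : 0 <= B / (1 - alpha) * x by rewrite mulr_ge0// divr_ge0//; lra.
have -> : A * v / alpha = A / alpha * v by rewrite mulrAC.
have -> : B * z / (1 - alpha) = B / (1 - alpha) * z by rewrite mulrAC.
lra.
Qed.

(** * Symmetric differences of Hoelder functions *)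

Lemma le_powR (R : realType) (alpha x y : R) :
  0 < alpha -> 0 <= x -> x <= y -> x `^ alpha <= y `^ alpha.
Proof.
move=> al0 x0 xy; apply: ge0_ler_powR => //; first exact: ltW.
by rewrite nnegrE (le_trans x0).
Qed.

Definition holder (R : realType) (alpha K : R) (g : R -> R) :=
  forall x y, `|g x - g y| <= K * `|x - y| `^ alpha.

Definition symdiff (R : realType) (g : R -> R) (x h : R) : R :=
  g (x + h) - g (x - h).

Lemma holder_continuous (R : realType) (alpha K : R) (g : R -> R) :
  0 < alpha -> 0 <= K -> holder alpha K g -> continuous g.
Proof.
move=> al0 K0 gH x; apply/cvgrPdist_le => /= e e0.
pose d := (e / (K + 1)) `^ alpha^-1.
have eK0 : 0 < e / (K + 1) by rewrite divr_gt0//; lra.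
have d0 : 0 < d by exact: powR_gt0.
near=> y; apply: (le_trans (gH x y)).
have xyd : `|x - y| <= d by near: y; exact: cvgr_dist_le.
have : `|x - y| `^ alpha <= e / (K + 1).
  have -> : e / (K + 1) = d `^ alpha by rewrite -powRrM mulVf ?gt_eqF// powRr1// ltW.
  by apply: le_powR.
move=> /(ler_wpM2l K0) /le_trans; apply.
by rewrite mulrA ler_pdivrMr; [nra|lra].
Unshelve. all: by end_near. Qed.

Lemma symdiff_continuous (R : realType) (g : R -> R) (x : R) :
  continuous g -> continuous (symdiff g x).
Proof.
move=> cg h; apply: cvgB.
- apply: (@continuous_comp _ _ _ (fun h => x + h) g h); last exact: cg.
  by apply: cvgD; [exact: cvg_cst|exact: cvg_id].
- apply: (@continuous_comp _ _ _ (fun h => x - h) g h); last exact: cg.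
  by apply: cvgB; [exact: cvg_cst|exact: cvg_id].
Qed.

Lemma powR_negK (R : realType) (x a : R) : 0 < x -> x `^ a * x `^ (- a) = 1.
Proof. by move=> x0; rewrite powRN divff// gt_eqF// powR_gt0. Qed.

(** Moving [x] by at most [a] changes the symmetric difference by
    [2 K a^alpha], and the kernel has mass at most [a^(-alpha) / alpha] above
    [a]. *)
Lemma kernel_integral_symdiff_dist (R : realType) (alpha K a b x y : R) (g : R -> R) :
  0 < alpha < 1 -> 0 <= K -> holder alpha K g -> 0 < a -> a <= b ->
  `|x - y| <= a ->
  `|kernel_integral alpha a b (symdiff g x) -
    kernel_integral alpha a b (symdiff g y)| <= 2 * K / alpha.
Proof.
move=> al01 K0 gH a0 ab xya; have /andP[al0 al1] := al01.
have cg := holder_continuous al0 K0 gH.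
rewrite -kernel_integralB//; [|exact: symdiff_continuous..].
have A0 : 0 <= 2 * K * a `^ alpha by rewrite !mulr_ge0// powR_ge0.
apply: (le_trans (kernel_integral_le (A := 2 * K * a `^ alpha) (B := 0)
  al01 a0 ab _ _ _ _)) => //.
- by move=> h; apply: cvgB; exact: symdiff_continuous.
- move=> h _; rewrite mul0r addr0 /symdiff.
  have -> : g (x + h) - g (x - h) - (g (y + h) - g (y - h)) =
    (g (x + h) - g (y + h)) - (g (x - h) - g (y - h)) by ring.
  apply: (le_trans (ler_normB _ _)).
  have := gH (x + h) (y + h); have := gH (x - h) (y - h).
  have -> : x - h - (y - h) = x - y by ring.
  have -> : x + h - (y + h) = x - y by ring.
  have : `|x - y| `^ alpha <= a `^ alpha.
    by apply: le_powR.
  move=> /(ler_wpM2l K0).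
  lra.
- by rewrite !mul0r addr0 -[2 * K * _ * _]mulrA powR_negK// mulr1.
Qed.

(** One dyadic range of [h] contributes [O(1)]: this bounds the increments
    between consecutive scales. *)
Lemma kernel_integral_symdiff_octave (R : realType) (alpha K a x : R) (g : R -> R) :
  0 < alpha < 1 -> 0 <= K -> holder alpha K g -> 0 < a ->
  `|kernel_integral alpha a (2 * a) (symdiff g x)| <= 4 * K / alpha.
Proof.
move=> al01 K0 gH a0; have /andP[al0 al1] := al01.
have cg := holder_continuous al0 K0 gH.
have A0 : 0 <= K * (4 * a) `^ alpha by rewrite !mulr_ge0// powR_ge0.
apply: (le_trans (kernel_integral_le (A := K * (4 * a) `^ alpha) (B := 0)
  al01 a0 _ _ _ _ _)) => //.
- lra.
- exact: symdiff_continuous.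
- move=> h /andP[ah ha]; rewrite mul0r addr0 /symdiff.
  apply: (le_trans (gH _ _)); apply: ler_wpM2l => //.
  have -> : x + h - (x - h) = 2 * h by ring.
  have h0 : 0 <= 2 * h by lra.
  by rewrite ger0_norm//; apply: le_powR => //; lra.
- rewrite !mul0r addr0 powRM//; last lra.
  have h4 : 4 `^ alpha <= 4 :> R by apply: ler1_powR; lra.
  have -> : K * (4 `^ alpha * a `^ alpha) * a `^ (- alpha) / alpha =
    K * 4 `^ alpha / alpha * (a `^ alpha * a `^ (- alpha)) by ring.
  rewrite powR_negK// mulr1 ler_pM2r ?invr_gt0// mulrC.
  exact: ler_wpM2r.
Qed.

(** Both sides are the sum of [F] over [0, n + p) minus its sums over [0, n) and
    over [0, p).  The point is to trade [n] differences at distance [p] for [p]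
    differences at distance [n]. *)
Lemma sum_shift_swap (V : zmodType) (F : nat -> V) (n p : nat) :
  \sum_(i < n) (F (i + p)%N - F i) = \sum_(i < p) (F (i + n)%N - F i).
Proof.
have E m k : \sum_(i < k) F (i + m)%N =
    \sum_(i < m + k) F i - \sum_(i < m) F i.
  rewrite big_split_ord/= [X in X - _]addrC addrK.
  by apply: eq_bigr => i _; rewrite addnC.
by rewrite !sumrB !E addnC addrAC.
Qed.

(** The cancellation at the heart of the proof: the second term, divided by [n],
    is of order [h (n d)^(alpha - 1)], much smaller than the trivial bound
    [K (2 h)^alpha] when [h] is small compared with [n d]. *)
Lemma symdiff_sum_le (R : realType) (alpha K d x h : R) (n : nat) (g : R -> R) :
  0 < alpha < 1 -> 0 <= K -> holder alpha K g -> 0 < d -> 0 <= h ->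
  `|\sum_(i < n) symdiff g (x + i%:R * d) h| <=
    n%:R * (K * d `^ alpha) + 2 * K / d * (n%:R * d) `^ alpha * h.
Proof.
move=> /andP[al0 al1] K0 gH d0 h0.
(* [p d] is [2 h] rounded down to a multiple of [d]. *)
pose p := Num.truncn (2 * h / d).
have /andP[pl pu] : p%:R <= 2 * h / d < p.+1%:R.
  by apply: truncn_itv; rewrite divr_ge0//; lra.
pose F (i : nat) := g (x - h + i%:R * d).
have -> : \sum_(i < n) symdiff g (x + i%:R * d) h =
    \sum_(i < n) (g (x + i%:R * d + h) - F (i + p)%N) +
    \sum_(i < p) (F (i + n)%N - F i).
  rewrite -sum_shift_swap -big_split/=; apply: eq_bigr => i _.
  rewrite /symdiff /F (_ : x - h + i%:R * d = x + i%:R * d - h); first by ring.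
  by ring.
apply: (le_trans (ler_normD _ _)); apply: lerD.
- apply: (le_trans (ler_norm_sum _ _ _)).
  rewrite mulr_natl -[n in _ *+ n]card_ord -sumr_const; apply: ler_sum => i _.
  apply: (le_trans (gH _ _)); apply: ler_wpM2l => //.
  apply: le_powR => //.
  have -> : x + i%:R * d + h - (x - h + (i + p)%:R * d) = (2 * h / d - p%:R) * d.
    by rewrite natrD; field; rewrite gt_eqF.
  rewrite -[leRHS]mul1r normrM (gtr0_norm d0) ler_pM2r// ger0_norm ?subr_ge0//.
  by rewrite lerBlDl -natr1 in pu *; lra.
- apply: (le_trans (ler_norm_sum _ _ _)).
  apply: (@le_trans _ _ (\sum_(i < p) K * (n%:R * d) `^ alpha)).
    apply: ler_sum => i _; apply: (le_trans (gH _ _)).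
    have -> : x - h + (i + n)%:R * d - (x - h + i%:R * d) = n%:R * d.
      by rewrite natrD; ring.
    by rewrite ger0_norm// mulr_ge0// ltW.
  rewrite sumr_const card_ord -[_ *+ p]mulr_natl.
  have -> : 2 * K / d * (n%:R * d) `^ alpha * h = 2 * h / d * (K * (n%:R * d) `^ alpha).
    by ring.
  by apply: ler_wpM2r => //; rewrite mulr_ge0// powR_ge0.
Qed.

(** The bound is independent of the number [n] of scales spanned: the contribution
    of the scales finer than [n d] averages out to [O(1)] over an interval of
    length [n d]. *)
Lemma kernel_integral_symdiff_sum (R : realType) (alpha K d x : R) (n : nat) (g : R -> R) :
  0 < alpha < 1 -> 0 <= K -> holder alpha K g -> 0 < d -> (0 < n)%N ->
  `|\sum_(i < n) kernel_integral alpha d (n%:R * d) (symdiff g (x + i%:R * d))|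
    <= n%:R * (K / alpha + 2 * K / (1 - alpha)).
Proof.
move=> al01 K0 gH d0 n0; have /andP[al0 al1] := al01.
have cg := holder_continuous al0 K0 gH.
have nd0 : 0 < n%:R * d by rewrite mulr_gt0// ltr0n.
rewrite -(kernel_integral_sum alpha (n%:R * d)
  (u := fun i => symdiff g (x + i%:R * d)))//; last first.
  by move=> i; exact: symdiff_continuous.
apply: (le_trans (kernel_integral_le (A := n%:R * (K * d `^ alpha)) 
  (B := 2 * K / d * (n%:R * d) `^ alpha) al01 d0 _ _ _ _ _)) => //.
- by rewrite ler_peMl ?ler1n// ltW.
- by rewrite !mulr_ge0// powR_ge0.
- by rewrite !mulr_ge0// ?powR_ge0// invr_ge0 ltW.
- apply: (continuous_sum_ord (u := fun i => symdiff g (x + i%:R * d))) => i.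
  exact: symdiff_continuous.
- by move=> h /andP[dh _]; apply: symdiff_sum_le => //; exact: le_trans (ltW d0) dh.
- have -> : (n%:R * d) `^ (1 - alpha) = n%:R * d / (n%:R * d) `^ alpha.
    rewrite powRB; last by apply/implyP => _; rewrite gt_eqF.
    by rewrite powRr1// ltW.
  rewrite powRN.
  have := powR_gt0 alpha d0; have := powR_gt0 alpha nd0.
  set y := powR _ _; set z := powR _ _ => y0 z0.
  rewrite le_eqVlt; apply/orP; left; apply/eqP; field.
  rewrite !gt_eqF//; lra.
Qed.

(** * A maximal inequality on the binary tree *)

(** A form of [cosh y <= exp (y^2 / 2)] with a worse constant.  For small [y] it
    comes from [exp z <= 1 / (1 - z)], applied to [y] and [- y], whose sum is
    [2 / (1 - y^2)]; for large [y] both exponents on the left are already below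
    [2 y^2]. *)
Lemma expR_add_expRN_le (R : realType) (y : R) :
  expR y + expR (- y) <= 2 * expR (2 * y ^+ 2).
Proof.
have [ylt|yge] := ltrP `|y| 2^-1.
  have /andP[y1 y2] : - 2^-1 < y < 2^-1 by rewrite -ltr_norml.
  have y3 : y ^+ 2 <= 2^-1 by nra.
  have inv (z : R) : `|z| < 2^-1 -> expR z <= (1 - z)^-1.
    rewrite ltr_norml => /andP[z1 z2].
    rewrite -[expR z]invrK -expRN lef_pV2 ?posrE ?expR_gt0//; last lra.
    exact: expR_ge1Dx.
  have h1 := inv y ylt.
  have h2 : expR (- y) <= (1 - - y)^-1 by apply: inv; rewrite normrN.
  apply: (le_trans (lerD h1 h2)).
  have := expR_ge1Dx (2 * y ^+ 2).
  move=> h; apply: (@le_trans _ _ (2 * (1 + 2 * y ^+ 2))); last by rewrite ler_pM2l.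
  have -> : (1 - y)^-1 + (1 - - y)^-1 = 2 / ((1 - y) * (1 + y)).
    by field; rewrite !gt_eqF//; lra.
  rewrite ler_pdivrMr; last by apply: mulr_gt0; lra.
  nra.
have [h1 h2] : y <= 2 * y ^+ 2 /\ - y <= 2 * y ^+ 2.
  by move: yge; rewrite ler_normr => /orP[] hy; split; nra.
have {}h1 : expR y <= expR (2 * y ^+ 2) by rewrite ler_expR.
have {}h2 : expR (- y) <= expR (2 * y ^+ 2) by rewrite ler_expR.
lra.
Qed.

(** The node [(m, a)] of the tree stands for the interval [[a, a + 2^m d]], whose
    children are its two halves at level [m - 1].  The recursion stops at the first
    node, from the root down, where [M] exceeds [s]; this stopping rule is what
    makes the inequality below a maximal one. *)
Fixpoint exceedance_set (R : realType) (d s : R) (M : nat -> R -> R)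
    (m : nat) (a : R) : set R :=
  if s < M m a then `[a, a + 2 ^+ m * d]%classic
  else if m is m'.+1 then
    exceedance_set d s M m' a `|` exceedance_set d s M m' (a + 2 ^+ m' * d)
  else set0.

Lemma measurable_exceedance_set (R : realType) (d s : R) (M : nat -> R -> R)
    (m : nat) (a : R) :
  measurable (exceedance_set d s M m a : set (measurableTypeR R)).
Proof.
elim: m a => [|m IH] a /=; case: ifP => _.
- exact: measurable_itv.
- exact: measurable0.
- exact: measurable_itv.
- by apply: measurableU; exact: IH.
Qed.

(** Since [M] approximates [theta k] on every interval of level [k], a point where
    [theta k] exceeds [s + C] has an ancestor of level [k] where [M] exceeds
    [s]. *)
Lemma sub_exceedance_set (R : realType) (d s : R) (M : nat -> R -> R)
    (theta : nat -> R -> R) (C : R) (n : nat) :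
  0 < d ->
  (forall m a x, (m <= n)%N -> a <= x <= a + 2 ^+ m * d ->
    `|M m a - theta m x| <= C) ->
  forall m k a x, (k <= m <= n)%N -> a <= x <= a + 2 ^+ m * d ->
    s + C < theta k x -> exceedance_set d s M m a x.
Proof.
move=> d0 MC; elim=> [|m IH] k a x /andP[km mn] axb sth.
  have k0 : k = 0%N by apply/eqP; rewrite -leqn0.
  rewrite {}k0 in sth.
  have := MC 0%N a x mn axb; rewrite ler_norml => /andP[h1 h2] /=.
  by rewrite ifT; [rewrite /= in_itv/=|lra].
rewrite /=; case: ifPn => [_|/negP sM]; first by rewrite /= in_itv.
have [km1|km1] := eqVneq k m.+1.
  have := MC m.+1 a x mn axb; rewrite ler_norml => /andP[h1 h2] /=.
  by rewrite km1 in sth; case: sM; lra.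
have {}km : (k <= m <= n)%N by rewrite (ltnW mn) andbT -ltnS ltn_neqAle km1.
have [xl|xr] := lerP x (a + 2 ^+ m * d).
  by left; apply: (IH k) => //; move: axb => /andP[-> _].
right; apply: (IH k) => //; rewrite (ltW xr)/=.
move: axb => /andP[_]; rewrite exprS; lra.
Qed.

(** The maximal form of Azuma's inequality, by induction on the level.  If the
    recursion stops at the node, the exponent is nonnegative and the measure is at
    most that of the interval.  Otherwise the bounds of the two children have
    values [M + e] and [M - e], and adding them costs a factor
    [cosh (lam e) <= exp (2 (lam D)^2)]. *)
Lemma exceedance_set_measure (R : realType) (d s : R) (M : nat -> R -> R)
    (D lam : R) (n : nat) :
  0 < d -> 0 <= lam ->
  (forall m a, (m < n)%N -> exists2 e, `|e| <= D &
    M m a = M m.+1 a + e /\ M m (a + 2 ^+ m * d) = M m.+1 a - e) ->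
  forall m a, (m <= n)%N ->
    (lebesgue_measure (exceedance_set d s M m a) <=
     (2 ^+ m * d * expR (lam * (M m a - s) + m%:R * (2 * (lam * D) ^+ 2)))%:E)%E.
Proof.
move=> d0 lam0 Me.
have full m a : s < M m a -> 
    (lebesgue_measure (`[a, (a + 2 ^+ m * d)%R]%classic : set R) <=
     (2 ^+ m * d * expR (lam * (M m a - s) + m%:R * (2 * (lam * D) ^+ 2)))%:E)%E.
  move=> sM; have md : 0 < 2 ^+ m * d by rewrite mulr_gt0// exprn_gt0.
  rewrite lebesgue_measure_itv/= lte_fin ltrDl md -EFinB lee_fin addrAC subrr add0r.
  rewrite ler_pMr// -[leLHS]expR0 ler_expR addr_ge0//.
    by rewrite mulr_ge0// subr_ge0 ltW.
  by apply: mulr_ge0 => //; apply: mulr_ge0 => //; exact: sqr_ge0.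
elim=> [|m IH] a mn; rewrite [exceedance_set _ _ _ _ _]/=; case: ifPn => sM.
- exact: full.
- by rewrite measure0 lee_fin mulr_ge0 ?expR_ge0// mulr_ge0// ltW.
- exact: full.
- apply: (le_trans (measureU2 _ _ _)); [exact: measurable_exceedance_set..|].
  apply: (le_trans (leeD (IH _ (ltnW mn)) (IH _ (ltnW mn)))).
  have [e eD [-> ->]] := Me m a mn.
  rewrite -EFinD lee_fin; set X := M m.+1 a; set Y := 2 * (lam * D) ^+ 2.
  have -> : lam * (X + e - s) + m%:R * Y = (lam * (X - s) + m%:R * Y) + lam * e by ring.
  have -> : lam * (X - e - s) + m%:R * Y = (lam * (X - s) + m%:R * Y) + - (lam * e) by ring.
  have -> : lam * (X - s) + m.+1%:R * Y = (lam * (X - s) + m%:R * Y) + Y.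
    by rewrite -natr1; ring.
  rewrite !expRD exprS.
  have pos : 0 <= 2 ^+ m * d * expR (lam * (X - s)) * expR (m%:R * Y).
    by rewrite !mulr_ge0 ?expR_ge0 ?exprn_ge0// ltW.
  have : expR (lam * e) + expR (- (lam * e)) <= 2 * expR Y.
    apply: (le_trans (expR_add_expRN_le _)).
    rewrite ler_pM2l// ler_expR ler_pM2l// !exprMn.
    apply: ler_wpM2l; first exact: sqr_ge0.
    by rewrite -[e ^+ 2]real_normK ?num_real// lerXn2r// nnegrE// (le_trans _ eD).
  move=> /(ler_wpM2l pos).
  lra.
Qed.

(** * Dyadic averages of the truncated integrals *)

(** The value at the node [(m, a)] of the martingale closed by the integral
    truncated at [d]; sampling that integral at the left endpoints of the leaves
    replaces conditional expectation. *)
Definition dyadic_average (R : realType) (alpha d : R) (g : R -> R)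
    (m : nat) (a : R) : R :=
  (\sum_(i < 2 ^ m) kernel_integral alpha d 1 (symdiff g (a + i%:R * d)))
    / 2 ^+ m.

Lemma dyadic_averageS (R : realType) (alpha d a : R) (g : R -> R) (m : nat) :
  dyadic_average alpha d g m.+1 a =
  (dyadic_average alpha d g m a +
   dyadic_average alpha d g m (a + 2 ^+ m * d)) / 2.
Proof.
rewrite /dyadic_average expnS mul2n -addnn big_split_ord/= exprS.
rewrite [X in (_ + X) / _ = _](_ : _ = \sum_(i < 2 ^ m)
  kernel_integral alpha d 1 (symdiff g (a + 2 ^+ m * d + i%:R * d))).
  by field; rewrite expf_neq0.
apply: eq_bigr => i _; congr kernel_integral; congr symdiff.
by rewrite natrD natrX; ring.
Qed.

(** Splitting the integrals at [2^m d], the fine scales average out to [O(1)] and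
    the coarse ones oscillate by [O(1)] on the interval. *)
Lemma dyadic_average_dist (R : realType) (alpha K d a x : R) (g : R -> R)
    (m : nat) :
  0 < alpha < 1 -> 0 <= K -> holder alpha K g -> 0 < d -> 2 ^+ m * d <= 1 ->
  a <= x <= a + 2 ^+ m * d ->
  `|dyadic_average alpha d g m a -
    kernel_integral alpha (2 ^+ m * d) 1 (symdiff g x)| <=
  3 * K / alpha + 2 * K / (1 - alpha).
Proof.
move=> al01 K0 gH d0 md1 axb; have /andP[al0 al1] := al01.
have cg := holder_continuous al0 K0 gH.
have p0 : 0 < 2 ^+ m :> R by rewrite exprn_gt0.
have dmd : d <= 2 ^+ m * d by rewrite ler_pMl// exprn_ege1// ler1n.
rewrite -(ler_pM2l p0) -{1}(gtr0_norm p0) -normrM mulrBr.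
rewrite /dyadic_average mulrC divfK ?gt_eqF//.
pose S1 := \sum_(i < 2 ^ m)
  kernel_integral alpha d ((2 ^ m)%:R * d) (symdiff g (a + i%:R * d)).
pose S2 := \sum_(i < 2 ^ m)
  (kernel_integral alpha (2 ^+ m * d) 1 (symdiff g (a + i%:R * d)) -
   kernel_integral alpha (2 ^+ m * d) 1 (symdiff g x)).
rewrite [X in `|X|](_ : _ = S1 + S2); last first.
  rewrite /S2 sumrB sumr_const card_ord -[_ *+ 2 ^ m]mulr_natl natrX addrA; congr (_ - _).
  rewrite -big_split/=; apply: eq_bigr => i _; rewrite natrX.
  by apply: kernel_integral_cat => //; exact: symdiff_continuous.
have S1le : `|S1| <= (2 ^ m)%:R * (K / alpha + 2 * K / (1 - alpha)).
  by apply: kernel_integral_symdiff_sum => //; rewrite expn_gt0.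
have S2le : `|S2| <= (2 ^ m)%:R * (2 * K / alpha).
  apply: (le_trans (ler_norm_sum _ _ _)).
  have -> : (2 ^ m)%:R * (2 * K / alpha) = \sum_(i < 2 ^ m) (2 * K / alpha).
    by rewrite sumr_const card_ord mulr_natl.
  apply: ler_sum => i _.
  apply: kernel_integral_symdiff_dist => //; first by rewrite mulr_gt0.
  have i0 : 0 <= i%:R * d by rewrite mulr_ge0// ltW.
  have i1 : i%:R * d <= 2 ^+ m * d.
    by rewrite ler_pM2r// -natrX ler_nat ltnW.
  rewrite ler_norml; lra.
apply: (le_trans (ler_normD _ _)); apply: (le_trans (lerD S1le S2le)).
rewrite natrX; lra.
Qed.

(** The increment to the left child is compared with that of the truncated integral
    at [a], which covers a single dyadic range of [h]; the right child has the
    opposite increment by averaging. *)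
Lemma dyadic_average_children (R : realType) (alpha K d a : R) (g : R -> R)
    (m : nat) :
  0 < alpha < 1 -> 0 <= K -> holder alpha K g -> 0 < d -> 2 ^+ m.+1 * d <= 1 ->
  exists2 e, `|e| <= 10 * K / alpha + 4 * K / (1 - alpha) &
    dyadic_average alpha d g m a = dyadic_average alpha d g m.+1 a + e /\
    dyadic_average alpha d g m (a + 2 ^+ m * d) =
      dyadic_average alpha d g m.+1 a - e.
Proof.
move=> al01 K0 gH d0 md1; have /andP[al0 al1] := al01.
have cg := holder_continuous al0 K0 gH.
have md0 k : 0 < 2 ^+ k * d by rewrite mulr_gt0// exprn_gt0.
have md2 : 2 ^+ m.+1 * d = 2 * (2 ^+ m * d) by rewrite exprS mulrA.
have md1' : 2 ^+ m * d <= 1 by have := md0 m; lra.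
exists (dyadic_average alpha d g m a - dyadic_average alpha d g m.+1 a); last first.
  by split; [|rewrite dyadic_averageS]; field.
have aa k : a <= a <= a + 2 ^+ k * d by rewrite lexx lerDl ltW.
have := dyadic_average_dist al01 K0 gH d0 md1' (aa m).
have := dyadic_average_dist al01 K0 gH d0 md1 (aa m.+1).
have := kernel_integral_symdiff_octave a al01 K0 gH (md0 m).
rewrite (@kernel_integral_cat _ alpha (2 ^+ m * d) (2 ^+ m.+1 * d) 1)//; last 2 first.
- have := md0 m; lra.
- exact: symdiff_continuous.
rewrite -md2 !ler_norml => /andP[? ?] /andP[? ?] /andP[? ?].
by apply/andP; split; lra.
Qed.

(** The choice of [lam] in the maximal inequality.  With [q = sqrt n] and
    [r = t / D] the left-hand side is [r C / (2 D q) - r^2 / 8], at most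
    [r / 2 - r^2 / 8], and the claim reduces to [0 <= (r - 4)^2]. *)
Lemma tail_exponent_le (R : realType) (C D n t lam : R) :
  1 <= n -> 0 < D -> 0 <= C <= D -> 0 < t ->
  lam = t / (4 * Num.sqrt n * D ^+ 2) ->
  lam * (C - (Num.sqrt n * t - C)) + n * (2 * (lam * D) ^+ 2) <=
    1 - t ^+ 2 / (16 * D ^+ 2).
Proof.
move=> n1 D0 /andP[C0 CD] t0 lamE; have n0 : 0 < n by lra.
have q0 : 0 < Num.sqrt n by rewrite sqrtr_gt0.
have q2 : Num.sqrt n ^+ 2 = n by rewrite sqr_sqrtr// ltW.
have q1 : 1 <= Num.sqrt n by rewrite -sqrtr1 ler_wsqrtr.
rewrite {}lamE; set q := Num.sqrt n in q0 q1 q2 *; rewrite -{}q2.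
pose r := t / D.
have r0 : 0 < r by rewrite divr_gt0.
have -> : t / (4 * q * D ^+ 2) * (C - (q * t - C)) +
    q ^+ 2 * (2 * (t / (4 * q * D ^+ 2) * D) ^+ 2) =
    r / 2 * (C / D / q) - r ^+ 2 / 8.
  by rewrite /r; field; rewrite !gt_eqF.
have -> : t ^+ 2 / (16 * D ^+ 2) = r ^+ 2 / 16.
  by rewrite /r; field; rewrite gt_eqF.
have CDq : C / D / q <= 1.
  by rewrite ler_pdivrMr// mul1r (le_trans _ q1)// ler_pdivrMr// mul1r.
have rr : 0 <= r / 2 by lra.
have := ler_wpM2l rr CDq.
have := sqr_ge0 (r - 4).
nra.
Qed.

(** The level of exceedance is lowered from [sqrt N * t] to [sqrt N * t - C] to
    absorb the distance between [Theta] and the martingale. *)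
Lemma Theta_upper_tail (R : realType) (alpha K D : R) (g : R -> R) (N : nat) (t : R) :
  0 < alpha < 1 -> 0 < K -> holder alpha K g -> (0 < N)%N -> 0 < t ->
  D = 10 * K / alpha + 4 * K / (1 - alpha) ->
  exists2 E : set R, measurable (E : set (measurableTypeR R)) /\
    (lebesgue_measure E <= (expR (1 - t ^+ 2 / (16 * D ^+ 2)))%:E)%E &
    forall k x, (k <= N)%N -> 0 <= x <= 1 ->
      Num.sqrt N%:R * t < Theta alpha (2 ^- k) g x -> E x.
Proof.
move=> al01 K0 gH N0 t0 DE; have /andP[al0 al1] := al01.
pose d : R := 2 ^- N.
pose C := 3 * K / alpha + 2 * K / (1 - alpha).
have p0 k : 0 < 2 ^+ k :> R by rewrite exprn_gt0.
have d0 : 0 < d by rewrite invr_gt0.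
have dN : 2 ^+ N * d = 1 by rewrite divff// gt_eqF.
have dle m : (m <= N)%N -> 2 ^+ m * d = 2 ^- (N - m).
  move=> mN; rewrite /d -[in LHS](subnK mN) exprD invfM mulrCA divff ?mulr1// gt_eqF.
have dle1 m : (m <= N)%N -> 2 ^+ m * d <= 1.
  by move=> mN; rewrite dle// invf_le1// exprn_ege1// ler1n.
pose M := dyadic_average alpha d g.
pose s := Num.sqrt N%:R * t - C.
pose lam := t / (4 * Num.sqrt N%:R * D ^+ 2).
have C0 : 0 <= C by rewrite addr_ge0// divr_ge0// ?mulr_ge0//; lra.
have ka0 : 0 < K / alpha by rewrite divr_gt0.
have kb0 : 0 < K / (1 - alpha) by rewrite divr_gt0//; lra.
have CD : C <= D by rewrite /C DE; lra.
have D0 : 0 < D by rewrite DE; lra.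
have n0 : 1 <= N%:R :> R by rewrite ler1n.
(* The root is [[0, 1]], where the truncated integral at scale [1] vanishes, so
   that the root value of [M] is at most [C]. *)
exists (exceedance_set d s M N 0).
  split; first exact: measurable_exceedance_set.
  have lam0 : 0 <= lam by rewrite divr_ge0 ?mulr_ge0 ?sqrtr_ge0 ?sqr_ge0// ltW.
  have children m a : (m < N)%N -> exists2 e, `|e| <= D &
      M m a = M m.+1 a + e /\ M m (a + 2 ^+ m * d) = M m.+1 a - e.
    by move=> mN; rewrite DE; apply: dyadic_average_children (ltW K0) gH d0 (dle1 _ mN).
  apply: (le_trans (exceedance_set_measure s d0 lam0 children 0 (leqnn N))).
  rewrite dN mul1r lee_fin ler_expR.
  apply: le_trans (tail_exponent_le (C := C) n0 D0 _ t0 (erefl lam)); last by rewrite C0.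
  rewrite lerD2r; apply: ler_wpM2l => //; rewrite lerB//.
  have := @dyadic_average_dist _ alpha K d 0 0 g N al01 (ltW K0) gH d0 (dle1 _ (leqnn N)).
  rewrite lexx add0r dN ler01 => /(_ isT).
  rewrite [kernel_integral _ _ _ _]/kernel_integral set_itv1 Rintegral_set1 subr0.
  by rewrite ler_norml => /andP[].
move=> k x kN x01 sx.
apply: (@sub_exceedance_set _ d s M
  (fun m x => kernel_integral alpha (2 ^+ m * d) 1 (symdiff g x)) C N d0 _ N (N - k)).
- by move=> m a y mN ay; apply: dyadic_average_dist (ltW K0) gH d0 (dle1 _ mN) ay.
- by rewrite leq_subr leqnn.
- by rewrite dN add0r.
- by rewrite /s subrK dle ?leq_subr// subKn.
Qed.

(** * Reduction to the whole line and conclusion *)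

Definition clamp (R : realType) (x : R) : R := Num.max (-1) (Num.min 2 x).

Lemma clamp_itv (R : realType) (x : R) : clamp x \in `[(-1)%R, 2%R].
Proof.
rewrite in_itv/= /clamp; apply/andP; split.
  by rewrite le_max lexx.
rewrite ge_max ge_min lexx/= andbT; lra.
Qed.

Lemma clamp_id (R : realType) (x : R) : -1 <= x <= 2 -> clamp x = x.
Proof. by move=> /andP[x1 x2]; rewrite /clamp min_r// max_r. Qed.

Lemma clamp_dist (R : realType) (x y : R) : `|clamp x - clamp y| <= `|x - y|.
Proof.
rewrite ler_norml /clamp; have := ler_norm (x - y); have := lerNnormlW (lexx `|x - y|).
have m12 : Num.max (-1) 2 = 2 :> R by apply: max_r; lra.
by case: (leP 2 x) => ?; case: (leP 2 y) => ?; rewrite ?m12;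
  case: (leP (-1) x) => ?; case: (leP (-1) y) => ? *; apply/andP; split; lra.
Qed.

(** The infimum of the constants is at most [1], so an actual Hoelder constant lies
    below [2]; composing with the projection, which is 1-Lipschitz, preserves it. *)
Lemma holder_clamp (R : realType) (alpha : R) (f : R -> R) :
  0 < alpha -> Lambda alpha f -> holder_norm alpha f <= 1 ->
  holder alpha 2 (f \o @clamp R).
Proof.
move=> al0 fL fn.
have [C [C0 fC] C2] : exists2 C, holder_constants alpha f C & C < 2.
  have hi : has_inf (holder_constants alpha f).
    by split => //; exists 0 => C [/ltW].
  have [C fC Ci] := inf_adherent ltr01 hi.
  by exists C => //; apply: (lt_le_trans Ci); rewrite -/(holder_norm alpha f); lra.
move=> x y /=; apply: (le_trans (fC _ _ (clamp_itv x) (clamp_itv y))).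
apply: ler_pM; [exact: ltW|exact: powR_ge0|exact: ltW|].
by apply: le_powR => //; exact: clamp_dist.
Qed.

Lemma Theta_clamp (R : realType) (alpha eps x : R) (f : R -> R) :
  0 <= eps -> 0 <= x <= 1 ->
  Theta alpha eps (f \o @clamp R) x = Theta alpha eps f x.
Proof.
move=> e0 /andP[x0 x1]; apply: eq_Rintegral => h.
rewrite inE/= in_itv/= => /andP[eh h1].
by rewrite !clamp_id//; apply/andP; split; lra.
Qed.

Lemma ThetaN (R : realType) (alpha eps x : R) (g : R -> R) :
  0 < eps -> continuous g ->
  Theta alpha eps (fun y => - g y) x = - Theta alpha eps g x.
Proof.
move=> e0 cg; rewrite -[RHS]mulN1r -RintegralZl//.
  by apply: eq_Rintegral => h _; ring.
by apply: kernel_integrable => //; exact: symdiff_continuous.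
Qed.

(** Holds for arbitrary sets because the Lebesgue measure is the restriction of an
    outer measure defined on all of them.  It is applied to a level set of the
    maximal operator, covered by dyadic intervals. *)
Lemma lebesgue_measure_le_cover (R : realType) (A B : set R) :
  A `<=` B -> (lebesgue_measure A <= lebesgue_measure B)%E.
Proof. exact: (@le_mu_ext _ _ _ (@wlength R idfun)). Qed.

Theorem corollary4p2 (R : realType) (alpha : R) (halpha : 0 < alpha < 1) :
  exists2 c : R, 0 < c &
    forall (f : R -> R) (N : nat) (t : R),
      Lambda alpha f -> holder_norm alpha f <= 1 -> (0 < N)%N -> 0 < t ->
      (lebesgue_measure
         [set x : R | (0 <= x <= 1)%R /\
                      (Num.sqrt N%:R * t < Theta_star alpha N f x)%R]
       <= (c * expR (- t ^+ 2 / c))%:E)%E.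
Proof.
have /andP[al0 al1] := halpha.
pose D := 10 * 2 / alpha + 4 * 2 / (1 - alpha).
have D0 : 0 < D by rewrite addr_gt0// divr_gt0//; lra.
have e1 : 0 < expR 1 :> R := expR_gt0 1.
pose c := 2 * expR 1 + 16 * D ^+ 2.
have D2 : 0 < 16 * D ^+ 2 by rewrite mulr_gt0// exprn_gt0.
have c0 : 0 < c by rewrite addr_gt0// mulr_gt0.
exists c => // f N t fL fn N0 t0.
pose g := f \o @clamp R.
have gH : holder alpha 2 g by exact: holder_clamp.
have gHN : holder alpha 2 (fun x => - g x).
  by move=> x y; rewrite -opprD normrN; exact: gH.
have cg : continuous g by apply: holder_continuous gH.
have [E1 [mE1 E1le] E1P] := Theta_upper_tail halpha (ltr0n _ 2) gH N0 t0 (erefl D).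
have [E2 [mE2 E2le] E2P] := Theta_upper_tail halpha (ltr0n _ 2) gHN N0 t0 (erefl D).
apply: (@le_trans _ _ (lebesgue_measure (E1 `|` E2))).
  apply: lebesgue_measure_le_cover => x /= [x01 /sup_gt[]].
    by exists `|Theta alpha (2 ^- 1) f x|, 1%N => //=; rewrite N0.
  move=> _ [k /= /andP[k0 kN] <-].
  have pk : 0 < 2 ^- k :> R by rewrite invr_gt0 exprn_gt0.
  rewrite -(Theta_clamp alpha f (ltW pk) x01) ltr_normr => /orP[h|h].
    by left; exact: (E1P k x kN x01).
  by right; apply: (E2P k x kN x01); rewrite ThetaN.
apply: (le_trans (measureU2 _ mE1 mE2)); apply: (le_trans (leeD E1le E2le)).
rewrite -EFinD lee_fin expRD.
set u := expR (- _); have -> : expR 1 * u + expR 1 * u = 2 * expR 1 * u by ring.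
apply: ler_pM.
- by rewrite mulr_ge0// ltW.
- exact: expR_ge0.
- by rewrite lerDl ltW.
- rewrite ler_expR mulNr lerN2; apply: ler_pM => //; first exact: sqr_ge0.
  + by rewrite invr_ge0 ltW.
  + by rewrite lef_pV2 ?posrE// lerDr mulr_ge0// ltW.
Qed.
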